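(* Let $(V,\omega)$ be a real symplectic vector space of dimension $2n$, let $\Omega\in\Lambda^n(V^* )$ and let $L\in\mathrm{E}_\Omega$. A hyperplane $H$ of $L$ is characteristic for $\mathrm{E}_\Omega$ at $L$ if and only if $H$ is $\Omega^\sigma$-isotropic for some $\sigma\in\Lambda^{n-2}(V^* )$, where $\Omega^\sigma:=\Omega+\sigma\wedge\omega$.
   Context: $\mathcal{L}(V)$ is the smooth manifold of Lagrangian planes of $(V,\omega)$ ($n$-dimensional subspaces on which $\omega$ vanishes). For $\Omega\in\Lambda^n(V^* )$, $\mathrm{E}_\Omega=\{L\in\mathcal{L}(V)\mid\Omega|_L=0\}$. Near a point $L$ it is the zero set of $F(\widetilde L)=\Omega(w_1(\widetilde L),\dots,w_n(\widetilde L))$, where $w_1(\widetilde L),\dots,w_n(\widetilde L)$ is a basis of $\widetilde L$ depending smoothly on $\widetilde L$ (changing the basis multiplies $F$ by a nonvanishing function). For an isotropic subspace $U\subset V$, $U^{(1)}=\{\widetilde L\in\mathcal{L}(V)\mid\widetilde L\supseteq U\}$, a smooth submanifold. An isotropic subspace $U\subset L$ is characteristic for $\mathrm{E}_\Omega$ at $L\in\mathrm{E}_\Omega$ if $(dF)_L|_{T_LU^{(1)}}=0$. For an $n$-form $\Omega'\in\Lambda^n(V^* )$, a $k$-dimensional subspace $U=\langle e_1,\dots,e_k\rangle\subset V$ is called $\Omega'$-isotropic if $(e_1\wedge\cdots\wedge e_k)\,\lrcorner\,\Omega'=0$, i.e. $\Omega'(e_1,\dots,e_k,v_1,\dots,v_{n-k})=0$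 for all $v_1,\dots,v_{n-k}\in V$. *)

(* Defs.v *)
From HB Require Import structures.
From mathcomp Require Import all_boot all_order all_fingroup all_algebra.
From mathcomp Require Import all_classical all_reals all_analysis.

Set Implicit Arguments.
Unset Strict Implicit.
Unset Printing Implicit Defensive.

Import Order.TTheory GRing.Theory Num.Theory.
Import numFieldNormedType.Exports.

Local Open Scope classical_set_scope.
Local Open Scope ring_scope.

Section ExteriorForms.
Variables (R : realType) (V : vectType R).

(* Elements of Lambda^k(V^* ) are represented as functions
   a : ('I_k -> V) -> R satisfying [exterior_form a]. *)
Definition exterior_form k (a : ('I_k -> V) -> R) : Prop :=
  (forall (v : 'I_k -> V) (i : 'I_k) (c : R) (x y : V),
     a [eta v with i |-> c *: x + y] =
       c * a [eta v with i |-> x] + a [eta v with i |-> y]) /\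
  (forall (v : 'I_k -> V) (i j : 'I_k), i != j -> v i = v j -> a v = 0).

Definition ext_wedge k l (a : ('I_k -> V) -> R) (b : ('I_l -> V) -> R) :
    ('I_(k + l) -> V) -> R :=
  fun v => (k`! * l`!)%:R^-1 *
    \sum_(s : 'S_(k + l)) (-1) ^+ s *
      (a (fun i => v (s (lshift l i))) * b (fun j => v (s (rshift k j)))).

Definition two_form (omega : V -> V -> R) : ('I_2 -> V) -> R :=
  fun v => omega (v ord0) (v ord_max).

(* sigma /\ omega as an n-form, for sigma of degree n - 2.  For n < 2 the space
   Lambda^(n-2)(V^* ) is zero, so the product is the zero form. *)
Definition wedge_omega (omega : V -> V -> R) n :
    (('I_n.-2 -> V) -> R) -> ('I_n -> V) -> R :=
  match n return (('I_n.-2 -> V) -> R) -> ('I_n -> V) -> R with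
  | m.+2 => fun sigma v =>
      ext_wedge sigma (two_form omega) (fun i => v (cast_ord (addn2 m) i))
  | _ => fun _ _ => 0
  end.

Definition twist (omega : V -> V -> R) n (Omega : ('I_n -> V) -> R)
    (sigma : ('I_n.-2 -> V) -> R) : ('I_n -> V) -> R :=
  fun v => Omega v + wedge_omega omega sigma v.

Definition form_isotropic n (Omega : ('I_n -> V) -> R) (U : {vspace V}) : Prop :=
  forall (e : (\dim U).-tuple V) (v : (n - \dim U).-tuple V),
    basis_of U e -> Omega (fun i => nth 0 (e ++ v) i) = 0.

End ExteriorForms.

Section Smoothness.
Variables (R : realType) (E W : normedModType R).

Fixpoint Ck_on (k : nat) (A : set E) (f : E -> W) : Prop :=
  if k is k'.+1 then
    (forall x, A x -> differentiable f x) /\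
    (forall v, Ck_on k' A (fun x => 'D_v f x))
  else forall x, A x -> {for x, continuous f}.

Definition smooth_near (x : E) (f : E -> W) : Prop :=
  exists A : set E, [/\ open A, A x & forall k, Ck_on k A f].

End Smoothness.

Section LagrangianGrassmannian.
Variables (R : realType) (V : vectType R) (omega : V -> V -> R) (n : nat).

Definition lagrangian (L : {vspace V}) : Prop :=
  \dim L = n /\ {in L &, forall u v, omega u v = 0}.

Definition in_E (Omega : ('I_n -> V) -> R) (L : {vspace V}) : Prop :=
  lagrangian L /\
  (forall v : 'I_n -> V, (forall i, v i \in L) -> Omega v = 0).

(* L(V) is viewed as a submanifold of the Grassmannian of n-planes.  A basis e
   of L together with a basis f of a complement gives the standard chart of the
   Grassmannian centred at L: the matrix S stands for the plane spanned by the
   vectors e_i + \sum_j S_ij f_j. *)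
Definition chart_at (L : {vspace V}) (e f : n.-tuple V) : Prop :=
  basis_of L e /\ basis_of fullv (e ++ f).

Definition plane (e f : n.-tuple V) (S : 'M[R]_n) : {vspace V} :=
  <<[tuple (tnth e i + \sum_j S i j *: tnth f j)%R | i < n]>>%VS.

(* A basis of the planes of L(V) near L, depending smoothly on the plane.
   As usual for a submanifold, smoothness means that in the chart the map is
   the restriction of a smooth map defined on an open set of matrices. *)
Definition smooth_frame (e f : n.-tuple V) (w : 'M[R]_n -> n.-tuple V) : Prop :=
  (forall (i : 'I_n) (phi : {linear V -> R^o}),
      smooth_near (0 : 'M[R]_n) (fun S => phi (tnth (w S) i))) /\
  (\forall S \near (0 : 'M[R]_n),
      lagrangian (plane e f S) -> basis_of (plane e f S) (w S)).

Definition local_F (Omega : ('I_n -> V) -> R) (w : 'M[R]_n -> n.-tuple V) :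
    'M[R]_n -> R :=
  fun S => Omega (tnth (w S)).

Definition prolongation (U : {vspace V}) : set {vspace V} :=
  [set L | lagrangian L /\ (U <= L)%VS].

(* T_L U^(1) in the chart: velocities of smooth curves of U^(1) through L. *)
Definition tangent_prolongation (U : {vspace V}) (e f : n.-tuple V) :
    set 'M[R]_n :=
  [set X | exists g : R -> 'M[R]_n,
     [/\ smooth_near (0 : R) g, g 0 = 0,
         \forall t \near (0 : R), prolongation U (plane e f (g t))
       & derive1 g 0 = X]].

(* (dF)_L vanishes on T_L U^(1).  The condition depends neither on the chart
   nor on the frame, so it is required for all of them. *)
Definition characteristic_at (Omega : ('I_n -> V) -> R) (L U : {vspace V}) : Prop :=
  forall (e f : n.-tuple V) (w : 'M[R]_n -> n.-tuple V),
    chart_at L e f -> smooth_frame e f w ->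
    forall X, tangent_prolongation U e f X ->
      'd (local_F Omega w) (0 : 'M[R]_n) X = 0.

End LagrangianGrassmannian.

(* Main.v *)
Require Import Defs.
From HB Require Import structures.
From mathcomp Require Import all_boot all_order all_fingroup all_algebra.
From mathcomp Require Import all_classical all_reals all_analysis.
Set Implicit Arguments.
Unset Strict Implicit.
Unset Printing Implicit Defensive.
Import Order.TTheory GRing.Theory Num.Theory.
Import numFieldNormedType.Exports.
Local Open Scope ring_scope.

(** Write [H^o] for the [omega]-orthogonal of [H], let [h] be a basis of [H] and
    let [x] complete it to a basis of [L].  Both sides of the equivalence say
    that

      Omega (h_1, ..., h_(n-1), u) = 0   for every u in H^o.           (P)

    Characteristic hyperplanes.  A Lagrangian plane containing [H] lies in
    [H^o], so it is spanned by [H] and one vector of [H^o].  Under (P) the local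
    equation of [E_Omega] therefore vanishes identically on [H^(1)] near [L],
    and so does its differential along every curve of [H^(1)]
    ([characteristic_of_perp]).  Conversely, for [u] in [H^o] the planes
    [H + <x + t u>] form a curve of [H^(1)] through [L] on which the local
    equation is [t * Omega (h, u)], whose derivative is [Omega (h, u)]
    ([perp_of_characteristic]).

    Isotropic hyperplanes.  The form [sigma /\ omega] vanishes on [(h, u)] when
    [u] is in [H^o], because [omega] vanishes on all pairs; so if [H] is
    isotropic for some [Omega^sigma], (P) holds.  Conversely (P) says that the
    linear form [Omega (h, -)] vanishes wherever all [omega (h_i, -)] do, hence
    it is a combination of them ([scalar_combination]).  It remains to see that
    every combination of the [omega (h_i, -)] is [(sigma /\ omega) (h, -)] for
    some [sigma]: if [vol] is the volume form of [H], extended to [V], and [z]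
    is a vector of [H], then contracting [vol] with [z] gives a [sigma] for which
    this linear form is a nonzero multiple of [omega (z, -)]
    ([exists_wedge_omega]).

    Changing the basis of [H] multiplies [Omega^sigma (h, u)] by a determinant
    ([exterior_form_det]), so one basis suffices. *)

(** * Multilinear and alternating functions *)

Section Multilinear.
Variables (R : realType) (V : vectType R).

Definition set_arg T n (v : 'I_n -> T) (i : 'I_n) (x : T) : 'I_n -> T :=
  [eta v with i |-> x].

Definition multilinear n (a : ('I_n -> V) -> R) : Prop :=
  forall (v : 'I_n -> V) (i : 'I_n) (c : R) (x y : V),
    a (set_arg v i (c *: x + y)) =
      c * a (set_arg v i x) + a (set_arg v i y).

Lemma scalar_lin_sum (f : V -> R) n (c : 'I_n -> R) (b : 'I_n -> V) :
  scalar f -> f (\sum_i c i *: b i) = \sum_i c i * f (b i).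
Proof.
move=> lf; elim/big_rec2: _ => [|i y x _ <-]; last exact: lf.
by have := lf 1 0 0; rewrite scaler0 addr0 mul1r => /eqP;
  rewrite -subr_eq0 opprD addrA subrr sub0r oppr_eq0 => /eqP.
Qed.

Lemma multilinear_sum n (a : ('I_n -> V) -> R) (v : 'I_n -> V) i m
    (c : 'I_m -> R) (e : 'I_m -> V) : multilinear a ->
  a (set_arg v i (\sum_j c j *: e j)) =
    \sum_j c j * a (set_arg v i (e j)).
Proof.
move=> ml.
exact: (@scalar_lin_sum (fun x => a (set_arg v i x)) _ c e (ml v i)).
Qed.

Definition fcons T n (x : T) (w : 'I_n -> T) : 'I_n.+1 -> T :=
  fun i => oapp w x (unlift ord0 i).

Lemma fcons0 T n (x : T) (w : 'I_n -> T) : fcons x w ord0 = x.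
Proof. by rewrite /fcons unlift_none. Qed.

Lemma fconsS T n (x : T) (w : 'I_n -> T) i : fcons x w (lift ord0 i) = w i.
Proof. by rewrite /fcons liftK. Qed.

Lemma set_arg_fcons0 n (x y : V) (w : 'I_n -> V) :
  set_arg (fcons x w) ord0 y = fcons y w.
Proof.
by apply/funext => i; rewrite /set_arg /=; case: (unliftP ord0 i) => [j|] ->;
  rewrite ?eqxx ?fcons0 ?fconsS.
Qed.

Lemma set_arg_fconsS n (x y : V) (w : 'I_n -> V) i :
  set_arg (fcons x w) (lift ord0 i) y = fcons x (set_arg w i y).
Proof.
apply/funext => k; rewrite /set_arg /=; case: (unliftP ord0 k) => [j|] ->;
  by rewrite ?fcons0 ?fconsS.
Qed.

(** Expand the first argument, then the others by induction: fixing the first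
    argument leaves a multilinear function of the remaining ones. *)
Lemma multilinear_expand n m (a : ('I_n -> V) -> R) (e : 'I_m -> V)
    (c : 'I_n -> 'I_m -> R) : multilinear a ->
  a (fun i => \sum_j c i j *: e j) =
    \sum_(f : {ffun 'I_n -> 'I_m}) (\prod_i c i (f i)) * a (e \o f).
Proof.
elim: n a c => [|n IHn] a c ml.
  have -> : forall v, a v = a (fun=> 0).
    by move=> v; congr a; apply/funext => -[].
  rewrite (eq_bigr (fun=> a (fun=> 0))) => [|f _]; last first.
    by rewrite big_ord0 mul1r; congr a; apply/funext => -[].
  by rewrite sumr_const cardT -cardE card_ffun !card_ord expn0.
have -> : (fun i => \sum_j c i j *: e j) =
    set_arg (fcons 0 (fun i => \sum_j c (lift ord0 i) j *: e j)) ord0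
      (\sum_j c ord0 j *: e j).
  rewrite set_arg_fcons0; apply/funext => i.
  by case: (unliftP ord0 i) => [j|] ->; rewrite ?fcons0 ?fconsS.
rewrite multilinear_sum //.
under eq_bigr => j _.
  rewrite set_arg_fcons0 (IHn (fun w => a (fcons (e j) w))); last first.
    by move=> v i k x y; rewrite -!set_arg_fconsS; apply: ml.
  rewrite mulr_sumr; over.
rewrite pair_big /=.
rewrite [RHS](reindex (fun p : 'I_m * {ffun 'I_n -> 'I_m} =>
    [ffun i => fcons p.1 p.2 i])) /=; last first.
  exists (fun f : {ffun 'I_n.+1 -> 'I_m} =>
      (f ord0, [ffun i => f (lift ord0 i)])) => [[j f]|f] _ /=.
    rewrite ffunE fcons0; congr (_, _); apply/ffunP => i.
    by rewrite !ffunE fconsS.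
  apply/ffunP => i; rewrite ffunE.
  by case: (unliftP ord0 i) => [j|] ->; rewrite ?fcons0 ?fconsS ?ffunE.
apply: eq_bigr => -[j f] _ /=; rewrite mulrA; congr (_ * a _).
  rewrite big_ord_recl ffunE fcons0; congr (_ * _).
  by apply: eq_bigr => i _; rewrite ffunE fconsS.
apply/funext => i /=; rewrite ffunE.
by case: (unliftP ord0 i) => [k|] ->; rewrite ?fcons0 ?fconsS.
Qed.

End Multilinear.

Section Alternating.
Variables (R : realType) (V : vectType R).

(** Restates the definition with [set_arg], which rewriting can recognize. *)
Lemma exterior_formP n (a : ('I_n -> V) -> R) :
  exterior_form a -> multilinear a /\
    (forall (v : 'I_n -> V) i j, i != j -> v i = v j -> a v = 0).
Proof. by []. Qed.

(** Polarization: expand the zero value at the vector [v i + v j] placed in both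
    positions [i] and [j]. *)
Lemma exterior_form_tperm n (a : ('I_n -> V) -> R) (v : 'I_n -> V) i j :
  exterior_form a -> i != j -> a (v \o tperm i j) = - a v.
Proof.
move=> /exterior_formP[ml alt] ij.
pose w x y k := if k == i then x else if k == j then y else v k.
have wl x x' y : a (w (x + x') y) = a (w x y) + a (w x' y).
  have := ml (w 0 y) i 1 x x'; rewrite scale1r mul1r.
  have E z : set_arg (w 0 y) i z = w z y.
    by apply/funext => k; rewrite /set_arg /w /=; case: eqP.
  by rewrite !E.
have wr x y y' : a (w x (y + y')) = a (w x y) + a (w x y').
  have := ml (w x 0) j 1 y y'; rewrite scale1r mul1r.
  have E z : set_arg (w x 0) j z = w x z.
    apply/funext => k; rewrite /set_arg /w /=; case: (eqVneq k j) => // ->.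
    by rewrite eq_sym (negbTE ij).
  by rewrite !E.
have w0 x : a (w x x) = 0.
  by apply: (alt _ i j) => //; rewrite /w !eqxx; case: eqP.
have := w0 (v i + v j); rewrite wl !wr !w0 add0r addr0 => /eqP.
rewrite addrC addr_eq0 => /eqP wji.
have -> : v \o tperm i j = w (v j) (v i).
  apply/funext => k; rewrite /w /=.
  case: tpermP => [->|->|]; rewrite ?eqxx //.
    by rewrite eq_sym (negbTE ij).
  by move=> /eqP/negbTE -> /eqP/negbTE ->.
rewrite wji; congr (- a _); apply/funext => k; rewrite /w.
by case: eqP => [->|_] //; case: eqP => [->|].
Qed.

Lemma exterior_form_perm n (a : ('I_n -> V) -> R) (v : 'I_n -> V) (s : 'S_n) :
  exterior_form a -> a (v \o s) = (-1) ^+ s * a v.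
Proof.
move=> fa; have [ts -> /=] := prod_tpermP s.
elim: ts v => [|[i j] ts IH] v /=.
  rewrite big_nil odd_perm1 mul1r => _; congr a; apply/funext => k /=.
  by rewrite perm1.
move=> /andP[/= ij dts]; rewrite big_cons /= odd_mul_tperm ij.
have -> : v \o (tperm i j * \prod_(t <- ts) tperm t.1 t.2)%g =
   (v \o (\prod_(t <- ts) tperm t.1 t.2)%g) \o tperm i j.
  by apply/funext => k /=; rewrite permM.
by rewrite exterior_form_tperm // IH // signr_addb expr1 mulN1r mulNr.
Qed.

(** In the multilinear expansion the non-injective choices of indices vanish and
    the remaining ones are the terms of the Leibniz formula. *)
Lemma exterior_form_det n (a : ('I_n -> V) -> R) (e : 'I_n -> V)
    (C : 'M[R]_n) : exterior_form a ->
  a (fun i => \sum_j C i j *: e j) = \det C * a e.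
Proof.
move=> fa; have [ml alt] := exterior_formP fa; rewrite multilinear_expand //.
rewrite (bigID (fun f : {ffun 'I_n -> 'I_n} => injectiveb f)) /=.
rewrite [X in _ + X]big1 ?addr0 => [|f /injectivePn[i [j ij fij]]]; last first.
  by rewrite (alt _ i j) ?mulr0 //= fij.
rewrite (reindex (@pval _)) /=; last first.
  pose in_Sn := insubd (1%g : 'S_n).
  by exists in_Sn => /= f Uf; first apply: val_inj; apply: insubdK.
rewrite /determinant mulr_suml; apply: eq_big => [s|s _]; first exact: (valP s).
rewrite (_ : e \o pval s = e \o s); last by apply/funext => i /=; rewrite pvalE.
rewrite exterior_form_perm // mulrA [_ * (-1) ^+ _]mulrC; congr (_ * _ * _).
by apply: eq_bigr => i _; rewrite pvalE.
Qed.

End Alternating.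

(** * Wedge products are exterior forms *)

Section Closure.
Variables (R : realType) (V : vectType R).

Lemma exterior_form_add n (a b : ('I_n -> V) -> R) :
  exterior_form a -> exterior_form b -> exterior_form (fun v => a v + b v).
Proof.
move=> [mla alta] [mlb altb]; split=> [v i c x y|v i j ij vij].
  by rewrite mla mlb mulrDr !addrA; congr (_ + _); rewrite addrAC.
by rewrite (alta _ i j) // (altb _ i j) // addr0.
Qed.

Lemma set_arg_comp T k n (h : 'I_k -> 'I_n) (v : 'I_n -> T) p x : injective h ->
  set_arg v (h p) x \o h = set_arg (v \o h) p x.
Proof. by move=> hI; apply/funext => r; rewrite /set_arg /= (inj_eq hI). Qed.

Lemma set_arg_comp_notin T k n (h : 'I_k -> 'I_n) (v : 'I_n -> T) i x :
  (forall p, h p != i) -> set_arg v i x \o h = v \o h.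
Proof.
by move=> hi; apply/funext => r; rewrite /set_arg /= (negbTE (hi r)).
Qed.

Lemma exterior_form_reindex k n (h : 'I_k -> 'I_n) (a : ('I_k -> V) -> R) :
  bijective h -> exterior_form a -> exterior_form (fun v => a (v \o h)).
Proof.
move=> [h' hK h'K] /exterior_formP[ml alt]; split=> [v i c x y|v i j ij vij].
  have E t : set_arg v i t \o h = set_arg (v \o h) (h' i) t.
    by rewrite -{1}[i]h'K (set_arg_comp _ _ _ (can_inj hK)).
  by have := ml (v \o h) (h' i) c x y; rewrite -!E.
apply: (alt _ (h' i) (h' j)); first by rewrite (inj_eq (can_inj h'K)).
by rewrite /= !h'K.
Qed.

(** Each argument enters exactly one of the two factors of a term, which gives
    linearity.  If the arguments [i] and [j] agree, composing the permutations
    with the transposition of [i] and [j] changes only the signs, so the sum is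
    its own opposite. *)
Lemma exterior_form_wedge k l (a : ('I_k -> V) -> R) (b : ('I_l -> V) -> R) :
  exterior_form a -> exterior_form b -> exterior_form (ext_wedge a b).
Proof.
move=> /exterior_formP[mla alta] /exterior_formP[mlb altb].
rewrite /ext_wedge; split=> [v i c x y|v i j ij vij].
  rewrite mulrCA -mulrDr; congr (_ * _).
  rewrite mulr_sumr -big_split; apply: eq_bigr => s _ /=.
  pose hl := s \o @lshift k l; pose hr := s \o @rshift k l.
  have hlI : injective hl.
    by apply: inj_comp; [exact: perm_inj|exact: lshift_inj].
  have hrI : injective hr.
    by apply: inj_comp; [exact: perm_inj|exact: rshift_inj].
  pose T (w : 'I_(k + l) -> V) := a (w \o hl) * b (w \o hr).
  suff E : T (set_arg v i (c *: x + y)) =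
      c * T (set_arg v i x) + T (set_arg v i y).
    by rewrite [in RHS]mulrCA -mulrDr; congr (_ * _).
  rewrite /T -[i](permKV s); case: (split_ordP (s^-1%g i)) => p ->.
    have El t : set_arg v (s (lshift l p)) t \o hl = set_arg (v \o hl) p t.
      exact: set_arg_comp.
    have Er t : set_arg v (s (lshift l p)) t \o hr = v \o hr.
      by apply: set_arg_comp_notin => q; rewrite (inj_eq perm_inj) eq_rlshift.
    by rewrite !El !Er mla mulrDl mulrA.
  have El t : set_arg v (s (rshift k p)) t \o hl = v \o hl.
    by apply: set_arg_comp_notin => q; rewrite (inj_eq perm_inj) eq_lrshift.
  have Er t : set_arg v (s (rshift k p)) t \o hr = set_arg (v \o hr) p t.
    exact: set_arg_comp.
  by rewrite !El !Er mlb mulrDr mulrCA.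
rewrite [X in _ * X](_ : _ = 0) ?mulr0 //.
set S := \sum_s _; suff /eqP: S = - S.
  by rewrite -addr_eq0 -mulr2n mulrn_eq0 => /eqP.
rewrite {1}/S (reindex_inj (mulIg (tperm i j))) -sumrN.
apply: eq_bigr => s _ /=.
rewrite odd_permM odd_tperm ij signr_addb expr1 mulrN1 mulNr; congr (- (_ * _)).
have vt p : v (tperm i j p) = v p by case: tpermP => [->|->|//].
by congr (a _ * b _); apply/funext => p; rewrite permM vt.
Qed.

End Closure.

Section Symplectic.
Variables (R : realType) (V : vectType R) (omega : {skew_symmetric V}).

Lemma skewC u v : omega u v = - omega v u.
Proof. by have := hermC omega u v; rewrite expr1 mulN1r. Qed.

Lemma skew0 u : omega u u = 0.
Proof.
by have /eqP := skewC u u; rewrite -addr_eq0 -mulr2n mulrn_eq0 => /eqP.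
Qed.

Lemma skewPr u c v w : omega u (c *: v + w) = c * omega u v + omega u w.
Proof. by rewrite linearPr. Qed.

Lemma skewPl u c v w : omega (c *: v + w) u = c * omega v u + omega w u.
Proof. by rewrite linearPl. Qed.

Lemma exterior_form_two_form : exterior_form (two_form omega).
Proof.
have I2 (i : 'I_2) : i = ord0 \/ i = ord_max.
  by case: i => -[|[|//]] lt_i; [left|right]; apply: val_inj.
split=> [v i c x y|v i j]; rewrite /two_form /=.
  by case: (I2 i) => ->; rewrite /= ?skewPl ?skewPr.
by case: (I2 i) => ->; case: (I2 j) => -> //= _ ->; rewrite skew0.
Qed.

Lemma exterior_form_wedge_omega n (sigma : ('I_n.-2 -> V) -> R) :
  exterior_form sigma -> exterior_form (wedge_omega omega sigma).
Proof.
case: n sigma => [|[|n]] sigma fs; try by split=> *; rewrite /= ?mulr0 ?addr0.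
have bij : bijective (cast_ord (addn2 n)).
  by exists (cast_ord (esym (addn2 n))); [exact: cast_ordK|exact: cast_ordKV].
apply: (exterior_form_reindex bij).
by apply: exterior_form_wedge => //; exact: exterior_form_two_form.
Qed.

Lemma exterior_form_twist n (Omega : ('I_n -> V) -> R)
    (sigma : ('I_n.-2 -> V) -> R) :
  exterior_form Omega -> exterior_form sigma ->
  exterior_form (twist omega Omega sigma).
Proof.
move=> fO fs; apply: exterior_form_add => //.
exact: exterior_form_wedge_omega.
Qed.

Lemma wedge_omega_isotropic n (sigma : ('I_n.-2 -> V) -> R) (u : 'I_n -> V) :
  (forall i j, omega (u i) (u j) = 0) -> wedge_omega omega sigma u = 0.
Proof.
case: n sigma u => [|[|n]] sigma u iso //=.
rewrite /ext_wedge big1 ?mulr0 // => s _.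
by rewrite /two_form iso !mulr0.
Qed.

End Symplectic.

(** * The form sigma attached to a vector of a hyperplane *)

Section RowDet.
Variables (R : realType).

Lemma exterior_form_det_rows n :
  exterior_form (fun w : 'I_n -> 'rV[R]_n => \det (\matrix_i w i)).
Proof.
split=> [v i c x y|v i j ij vij]; last first.
  by apply: (determinant_alternate ij) => k; rewrite !mxE vij.
rewrite -[X in _ = _ + X]mul1r; apply: (determinant_multilinear (i0 := i)).
- by apply/rowP => k; rewrite !mxE /= eqxx !mxE mul1r.
- by apply/matrixP => r k; rewrite !mxE /= eq_sym (negbTE (neq_lift _ _)).
- by apply/matrixP => r k; rewrite !mxE /= eq_sym (negbTE (neq_lift _ _)).
Qed.

(** Expand the row [z] in the standard basis: any entry of [z] other than the
    one at [s i] multiplies a determinant with a repeated row. *)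
Lemma det_perm_set_row n (s : 'S_n) (i : 'I_n) (z : 'rV[R]_n) :
  \det (\matrix_r set_arg (fun r => delta_mx 0 (s r)) i z r) =
    (-1) ^+ s * z 0 (s i).
Proof.
have /exterior_formP[ml alt] := exterior_form_det_rows n.
rewrite [z in LHS]row_sum_delta (multilinear_sum _ _ _ _ ml).
rewrite (bigD1 (s i)) //= big1 ?addr0 => [|k ki]; last first.
  rewrite (alt _ i (s^-1%g k)) ?mulr0 //.
    by apply: contraNneq ki => ->; rewrite permKV.
  by rewrite /set_arg /= eqxx permKV; case: eqP.
rewrite mulrC; congr (_ * _).
rewrite -det_perm; congr (\det _); apply/matrixP => r k.
rewrite !mxE /set_arg /=.
by case: eqP => [->|_]; rewrite mxE eqxx /= eq_sym.
Qed.

End RowDet.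

Section Volume.
Variables (R : realType) (V : vectType R) (m : nat).
Variables (alpha : V -> 'rV[R]_(m + 2)).

Let pen : 'I_(m + 2) := rshift m ord0.
Let lst : 'I_(m + 2) := rshift m ord_max.

(** For a family [u] indexed by ['I_(m + 2)], [alpha] stands for coordinates
    dual to the [u i] with [i != lst]; these span the hyperplane.  The last row
    of the matrix is a unit vector, so the determinant is the volume form of the
    hyperplane contracted with the vector of coordinates [z].  Padding it to a
    square matrix of size [m + 2] makes the permutations of ['I_(m + 2)] of the
    wedge product act on its rows. *)
Definition volume_rows (z : 'rV[R]_(m + 2)) (v : 'I_m -> V) :
    'I_(m + 2) -> 'rV[R]_(m + 2) :=
  fun i => match fintype.split i with
    | inl p => alpha (v p)
    | inr q => if q == ord0 then z else delta_mx 0 lst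
    end.

Definition contracted_volume (z : 'rV[R]_(m + 2)) : ('I_m -> V) -> R :=
  fun v => \det (\matrix_i volume_rows z v i).

Lemma exterior_form_contracted_volume z :
  linear alpha -> exterior_form (contracted_volume z).
Proof.
move=> lin; have /exterior_formP[ml alt] := exterior_form_det_rows R (m + 2).
pose w := volume_rows z.
split=> [v i c x y|v i j ij vij]; rewrite /contracted_volume.
  have E t : w (set_arg v i t) = set_arg (w v) (lshift 2 i) (alpha t).
    apply/funext => r; rewrite /w /volume_rows /set_arg /=.
    case: (split_ordP r) => p ->.
      by rewrite (inj_eq (@lshift_inj _ _)); case: eqP.
    by rewrite eq_rlshift.
  have := ml (w v) (lshift 2 i) c (alpha x) (alpha y).
  by rewrite -lin -!E.
apply: (alt (w v) (lshift 2 i) (lshift 2 j)).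
  by rewrite (inj_eq (@lshift_inj _ _)).
by rewrite /w /volume_rows !(unsplitK (inl _)) vij.
Qed.

(** Every count with [k != lst] equals [m`!], but its positivity suffices to
    divide by it. *)
Definition perm_count (k : 'I_(m + 2)) : nat :=
  #|[pred s : 'S_(m + 2) | (s lst == lst) && (s pen == k)]|.

Lemma perm_count_gt0 k : k != lst -> (0 < perm_count k)%N.
Proof.
move=> k0; apply/card_gt0P; exists (tperm pen k); rewrite inE tpermL eqxx andbT.
by rewrite tpermD // (inj_eq (@rshift_inj _ _)).
Qed.

(** A permutation contributes only if it sends [pen] or [lst] to [lst], since
    [omega] vanishes on the other pairs; the two cases are exchanged by a
    transposition, whose sign is absorbed by the skew symmetry of [omega].  When
    [lst] is fixed, the determinant is the sign of the permutation times one
    coordinate of [z], and the two signs cancel. *)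
Lemma wedge_contracted_volume (omega : {skew_symmetric V}) z
    (u : 'I_(m + 2) -> V) :
  (forall i, i != lst -> alpha (u i) = delta_mx 0 i) ->
  (forall i j, i != lst -> j != lst -> omega (u i) (u j) = 0) ->
  ext_wedge (contracted_volume z) (two_form omega) u =
    m`!%:R^-1 * \sum_k (perm_count k)%:R * z 0 k * omega (u k) (u lst).
Proof.
move=> au iso.
pose G (s : 'S_(m + 2)) := (-1) ^+ s *
  (contracted_volume z (fun i => u (s (lshift 2 i))) *
   omega (u (s pen)) (u (s lst))).
have pen_lst : pen != lst by rewrite (inj_eq (@rshift_inj _ _)).
have -> : ext_wedge (contracted_volume z) (two_form omega) u =
    (m`! * 2`!)%:R^-1 * \sum_s G s by [].
have Gtw s : G (tperm pen lst * s)%g = G s.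
  rewrite /G odd_mul_tperm pen_lst signr_addb expr1 mulN1r !permM tpermL tpermR.
  rewrite [omega (u (s lst)) _]skewC !mulrN mulNr opprK; congr (_ * (_ * _)).
  congr contracted_volume; apply/funext => p.
  by rewrite permM tpermD // eq_rlshift.
have G0 (s : 'S_(m + 2)) : s lst != lst -> s pen != lst -> G s = 0.
  by move=> s0 s1; rewrite /G iso // !mulr0.
have G1 (s : 'S_(m + 2)) :
    s lst = lst -> G s = z 0 (s pen) * omega (u (s pen)) (u lst).
  move=> s0; rewrite /G s0 mulrA; congr (_ * _).
  rewrite /contracted_volume (_ : \matrix_i _ =
      \matrix_r set_arg (fun r => delta_mx 0 (s r)) pen z r).
    by rewrite det_perm_set_row mulrA -signr_addb addbb mul1r.
  apply/matrixP => i j; rewrite !mxE /volume_rows /set_arg /=.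
  case: (split_ordP i) => p ->.
    rewrite eq_lrshift au //.
    by rewrite -[X in _ != X]s0 (inj_eq perm_inj) eq_lrshift.
  rewrite (inj_eq (@rshift_inj _ _)); case: eqP => // p0.
  rewrite (_ : p = ord_max); first by rewrite s0.
  by case: p p0 => -[|[|//]] lt_p p0; [case: p0|]; exact: val_inj.
rewrite (bigID (fun s : 'S_(m + 2) => s lst == lst)) /=.
set S1 := \sum_(s : 'S_(m + 2) | s lst == lst) G s.
have -> : \sum_(s : 'S_(m + 2) | s lst != lst) G s = S1.
  rewrite (bigID (fun s : 'S_(m + 2) => s pen == lst)) /=.
  rewrite [X in _ + X]big1 ?addr0; last by move=> s /andP[]; exact: G0.
  rewrite (reindex_inj (mulgI (tperm pen lst))) /=; apply: eq_big => [s|s _] //.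
  rewrite !permM tpermL tpermR; case: (eqVneq (s pen) lst) => [s0|] //=.
  by rewrite -[X in _ == X]s0 (inj_eq perm_inj) eq_sym (negbTE pen_lst).
rewrite -mulr2n -[S1 *+ 2]mulr_natl natrM invfM -mulrA.
rewrite (_ : 2`!%:R^-1 * (2 * S1) = S1); last first.
  by rewrite mulrA mulVf ?mul1r ?pnatr_eq0.
congr (_ * _); rewrite /S1.
rewrite (partition_big (fun s : 'S_(m + 2) => s pen) predT) //=.
apply: eq_bigr => k _.
rewrite (eq_bigr (fun=> z 0 k * omega (u k) (u lst))); last first.
  by move=> s /andP[/eqP s0 /eqP s1]; rewrite G1 // s1.
by rewrite sumr_const -mulrA mulr_natl.
Qed.

End Volume.

Definition fsnoc T n (w : 'I_n -> T) (x : T) : 'I_n.+1 -> T :=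
  fun i => oapp w x (unlift ord_max i).

Lemma fsnoc_last T n (w : 'I_n -> T) x : fsnoc w x ord_max = x.
Proof. by rewrite /fsnoc unlift_none. Qed.

Lemma fsnoc_init T n (w : 'I_n -> T) x i : fsnoc w x (lift ord_max i) = w i.
Proof. by rewrite /fsnoc liftK. Qed.

Lemma big_fsnoc (R : nmodType) (n : nat) (F : 'I_n.+1 -> R) :
  \sum_i F i = \sum_i F (lift ord_max i) + F ord_max.
Proof.
rewrite big_ord_recr; congr (_ + _); apply: eq_bigr => i _; congr F.
by apply: val_inj; rewrite /= /bump leqNgt ltn_ord.
Qed.

Section Functionals.
Variables (R : realType) (V : vectType R).

(** A row vector lies in the row space of [A] as soon as it annihilates the
    columns of the cokernel of [A], which generate the common kernel. *)
Lemma scalar_combination p (phi : 'I_p -> V -> R) (xi : V -> R) :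
  (forall i, scalar (phi i)) -> scalar xi ->
  (forall x, (forall i, phi i x = 0) -> xi x = 0) ->
  exists c : 'I_p -> R, forall x, xi x = \sum_i c i * phi i x.
Proof.
move=> lphi lxi ker; pose b := vbasis (fullv : {vspace V}).
pose A : 'M[R]_(p, \dim (fullv : {vspace V})) := \matrix_(i, k) phi i b`_k.
pose X : 'rV[R]_(\dim (fullv : {vspace V})) := \row_k xi b`_k.
have /submxP[D XD] : (X <= A)%MS.
  rewrite submxE; apply/eqP/rowP => k; rewrite mxE [RHS]mxE.
  transitivity (xi (\sum_l cokermx A l k *: b`_l)).
    rewrite (scalar_lin_sum _ _ lxi).
    by apply: eq_bigr => l _; rewrite mxE mulrC.
  apply: ker => i; rewrite (scalar_lin_sum _ _ (lphi i)).
  have A0 : (A *m cokermx A) i k = 0 by rewrite mulmx_coker mxE.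
  rewrite -[RHS]A0 [RHS]mxE.
  by apply: eq_bigr => l _; rewrite [A i l]mxE mulrC.
exists (fun i => D 0 i) => x.
rewrite (coord_vbasis (memvf x)) (scalar_lin_sum _ _ lxi).
under [RHS]eq_bigr => i _ do rewrite (scalar_lin_sum _ _ (lphi i)) mulr_sumr.
rewrite exchange_big /=; apply: eq_bigr => k _.
have /rowP/(_ k) := XD; rewrite !mxE => ->; rewrite mulr_sumr.
by apply: eq_bigr => i _; rewrite !mxE mulrCA.
Qed.

End Functionals.

Section Correction.
Variables (R : realType) (V : vectType R) (omega : {skew_symmetric V}).

(** The contracted volume form, with the coordinates of [z] rescaled to cancel
    the factors [perm_count k / m`!]. *)
Lemma exists_wedge_omega p (h : p.-tuple V) (c : 'I_p -> R) :
  free h -> (forall i j, omega (tnth h i) (tnth h j) = 0) ->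
  exists sigma : ('I_p.+1.-2 -> V) -> R, exterior_form sigma /\
    forall x, wedge_omega omega sigma (fsnoc (tnth h) x) =
      \sum_i c i * omega (tnth h i) x.
Proof.
case: p h c => [|m] h c free_h iso.
  (* in degree 1 the wedge product and the sum are both zero *)
  exists (fun=> 0); split=> [|x]; last by rewrite big_ord0.
  by split=> *; rewrite ?mulr0 ?addr0.
pose cst := cast_ord (addn2 m).
have cstI : injective cst by apply: cast_ord_inj.
pose lst : 'I_(m + 2) := rshift m ord_max.
have cst_lst : cst lst = ord_max by apply: val_inj; rewrite /= addn1.
pose alpha y : 'rV[R]_(m + 2) :=
  \row_k fsnoc (fun j => coord h j y) 0 (cst k).
have lin_alpha : linear alpha.
  move=> a x y; apply/rowP => k; rewrite !mxE /fsnoc.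
  by case: unlift => [j|] /=; rewrite ?linearP // mulr0 addr0.
pose z : 'rV[R]_(m + 2) :=
  \row_k (m`!%:R / (perm_count k)%:R * fsnoc c 0 (cst k)).
exists (contracted_volume alpha z); split.
  exact: exterior_form_contracted_volume.
move=> x; pose u k := fsnoc (tnth h) x (cst k).
have ulst : u lst = x by rewrite /u cst_lst fsnoc_last.
have nlst k : k != lst -> exists j, cst k = lift ord_max j.
  rewrite -(inj_eq cstI) cst_lst; case: (unliftP ord_max (cst k)) => [j ->|->].
    by exists j.
  by rewrite eqxx.
have -> : @wedge_omega R V omega m.+2 (contracted_volume alpha z)
      (fsnoc (tnth h) x) =
    ext_wedge (contracted_volume alpha z) (two_form omega) u by [].
rewrite (wedge_contracted_volume z) =>
    [|i /nlst[j ij]|i j /nlst[i' ii'] /nlst[j' jj']];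
  last by rewrite /u ii' jj' !fsnoc_init.
  rewrite -/lst ulst.
  have bij : bijective cst.
    by exists (cast_ord (esym (addn2 m))); [exact: cast_ordK|exact: cast_ordKV].
  transitivity (\sum_k fsnoc c 0 (cst k) * omega (fsnoc (tnth h) x (cst k)) x).
    rewrite mulr_sumr; apply: eq_bigr => k _; rewrite mxE.
    have [->|k_lst] := eqVneq k lst.
      by rewrite -/(u lst) ulst skew0 !mulr0.
    have N0 : (perm_count k)%:R != 0 :> R.
      by rewrite pnatr_eq0 -lt0n perm_count_gt0.
    have f0 : m`!%:R != 0 :> R by rewrite pnatr_eq0 -lt0n fact_gt0.
    by rewrite -/(u k) [m`!%:R / _]mulrC -!mulrA (mulVKf N0) (mulKf f0).
  rewrite -(reindex cst (P := predT) (F := fun i =>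
     fsnoc c 0 i * omega (fsnoc (tnth h) x i) x)) /=; last exact: onW_bij.
  rewrite big_fsnoc !fsnoc_last mul0r addr0.
  by apply: eq_bigr => j _; rewrite !fsnoc_init.
apply/rowP => k; rewrite !mxE eqxx /u ij fsnoc_init -(inj_eq cstI) ij.
case: (unliftP ord_max (cst k)) => [l ->|->]; last first.
  by rewrite fsnoc_last (negbTE (neq_lift _ _)).
by rewrite fsnoc_init (inj_eq lift_inj) (tnth_nth 0) coord_free // eq_sym.
Qed.

End Correction.

(** * Isotropy for some twist of Omega *)

Section Vanishing.
Variables (R : realType) (V : vectType R).

Lemma exterior_form_comb_eq0 n (a : ('I_n -> V) -> R) (e w : 'I_n -> V) :
  exterior_form a -> a e = 0 ->
  (forall i, exists c : 'I_n -> R, w i = \sum_j c j *: e j) -> a w = 0.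
Proof.
move=> fa ae0 /choice[c wE].
have -> : w = fun i => \sum_j (\matrix_(i, j) c i j) i j *: e j.
  by apply/funext => i; rewrite wE; apply: eq_bigr => j _; rewrite mxE.
by rewrite exterior_form_det // ae0 mulr0.
Qed.

Lemma exterior_form_snoc_eq0 p (a : ('I_p.+1 -> V) -> R) (H : {vspace V})
    (h : p.-tuple V) x (w : 'I_p.+1 -> V) :
  exterior_form a -> basis_of H h -> a (fsnoc (tnth h) x) = 0 ->
  (forall i, exists2 y, y \in H & exists c, w i = y + c *: x) -> a w = 0.
Proof.
move=> fa bh ax0 wHx; apply: (exterior_form_comb_eq0 fa ax0) => i.
have [y yH [c ->]] := wHx i; exists (fsnoc (coord h ^~ y) c).
rewrite big_fsnoc !fsnoc_last; congr (_ + _); rewrite [LHS](coord_basis bh yH).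
by apply: eq_bigr => j _; rewrite !fsnoc_init (tnth_nth 0).
Qed.

Lemma fsnoc_scalar p (a : ('I_p.+1 -> V) -> R) (w : 'I_p -> V) :
  exterior_form a -> scalar (fun x => a (fsnoc w x)).
Proof.
move=> /exterior_formP[ml _] c x y.
have E z : fsnoc w z = set_arg (fsnoc w 0) ord_max z.
  apply/funext => i; rewrite /set_arg /=.
  case: (unliftP ord_max i) => [j|] ->; last by rewrite eqxx fsnoc_last.
  by rewrite eq_sym (negbTE (neq_lift _ _)) !fsnoc_init.
by rewrite (E (c *: x + y)) ml -(E x) -(E y).
Qed.

End Vanishing.

Section IsotropicTwist.
Variables (R : realType) (V : vectType R) (omega : {skew_symmetric V}).

Lemma nth_cat1 p (e : p.-tuple V) (v : 1.-tuple V) (s : seq V) :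
  s = e ++ v -> (fun i : 'I_p.+1 => nth 0 s i) = fsnoc (tnth e) (thead v).
Proof.
move=> ->; apply/funext => i; rewrite nth_cat size_tuple.
case: (unliftP ord_max i) => [j|] ->.
  by rewrite fsnoc_init lift_max ltn_ord (tnth_nth 0).
by rewrite fsnoc_last /= ltnn subnn /thead (tnth_nth 0).
Qed.

(** The form vanishes on every family of vectors of [H + <x>] once it vanishes
    on [(h, x)], so the basis of [H] can be fixed. *)
Lemma form_isotropic_snoc p (a : ('I_p.+1 -> V) -> R) (H : {vspace V})
    (h : p.-tuple V) : exterior_form a -> basis_of H h ->
  form_isotropic a H <-> forall x, a (fsnoc (tnth h) x) = 0.
Proof.
move=> fa bh; have dimH : \dim H = p := size_basis bh.
split=> [iso x|h0 e v be].
  have sh : size h == \dim H by rewrite size_tuple dimH.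
  have sx : size [:: x] == (p.+1 - \dim H)%N by rewrite dimH subSnn.
  have := iso (Tuple sh) (Tuple sx) bh.
  by rewrite (@nth_cat1 p h [tuple x] (h ++ [:: x])).
pose w (i : 'I_p.+1) := nth 0 (e ++ v) i; rewrite -/w.
apply: (exterior_form_snoc_eq0 (x := w ord_max) fa bh (h0 _)) => i.
case: (unliftP ord_max i) => [j|] ->; last first.
  by exists 0; [exact: mem0v | exists 1; rewrite scale1r add0r].
exists (w (lift ord_max j)); last by exists 0; rewrite scale0r addr0.
have lt_j : (lift ord_max j < size e)%N by rewrite lift_max size_tuple dimH.
by apply: (basis_mem be); rewrite /w nth_cat lt_j mem_nth.
Qed.

(** In the nontrivial direction [sigma] is chosen so that [sigma /\ omega]
    cancels the linear form [Omega (h, -)]. *)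
Lemma exists_isotropic_twist p (Omega : ('I_p.+1 -> V) -> R) (H : {vspace V})
    (h : p.-tuple V) :
  exterior_form Omega -> basis_of H h ->
  (forall i j, omega (tnth h i) (tnth h j) = 0) ->
  (exists sigma : ('I_p.+1.-2 -> V) -> R,
    exterior_form sigma /\ form_isotropic (twist omega Omega sigma) H) <->
  (forall x, (forall i, omega (tnth h i) x = 0) ->
    Omega (fsnoc (tnth h) x) = 0).
Proof.
move=> fO bh iso; split=> [[sigma [fs tw0]] x hx|O0].
  have := (form_isotropic_snoc (exterior_form_twist omega fO fs) bh).1 tw0 x.
  rewrite /twist wedge_omega_isotropic ?addr0 // => i j.
  case: (unliftP ord_max i) => [i'|] ->; case: (unliftP ord_max j) => [j'|] ->;
    rewrite ?fsnoc_init ?fsnoc_last ?iso ?skew0 ?hx //.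
  by rewrite skewC hx oppr0.
have lin_om i : scalar (omega (tnth h i)) by move=> c x y; rewrite skewPr.
have [c OE] := scalar_combination lin_om (fsnoc_scalar (tnth h) fO) O0.
have [sigma [fs sE]] :=
  exists_wedge_omega (fun i => - c i) (basis_free bh) iso.
exists sigma; split=> //.
apply/(form_isotropic_snoc (exterior_form_twist omega fO fs) bh) => x.
rewrite /twist sE OE -big_split big1 //= => i _.
by rewrite mulNr subrr.
Qed.

End IsotropicTwist.

(** * Differentiability of the local equation *)

Section Smooth.
Variables (R : realType).

Lemma differentiable_bigsum (E : normedModType R) (I : Type) (r : seq I)
    (f : I -> E -> R) (x : E) : (forall i, differentiable (f i) x) ->
  differentiable (fun y => \sum_(i <- r) f i y) x.
Proof.
move=> df; elim: r => [|i r IH].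
  rewrite (_ : (fun _ => _) = cst 0); last first.
    by apply/funext => y; rewrite big_nil.
  exact: differentiable_cst.
rewrite (_ : (fun _ => _) = f i + (fun y => \sum_(i <- r) f i y)).
  exact: differentiableD.
by apply/funext => y; rewrite big_cons.
Qed.

Lemma differentiable_bigprod (E : normedModType R) (I : Type) (r : seq I)
    (f : I -> E -> R) (x : E) : (forall i, differentiable (f i) x) ->
  differentiable (fun y => \prod_(i <- r) f i y) x.
Proof.
move=> df; elim: r => [|i r IH].
  rewrite (_ : (fun _ => _) = cst 1); last first.
    by apply/funext => y; rewrite big_nil.
  exact: differentiable_cst.
rewrite (_ : (fun _ => _) = f i * (fun y => \prod_(i <- r) f i y)).
  exact: differentiableM.
by apply/funext => y; rewrite big_cons.
Qed.

Lemma smooth_near_differentiable (E W : normedModType R) (f : E -> W) x :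
  smooth_near x f -> differentiable f x.
Proof. by move=> [A [_ Ax /(_ 1)[+ _]]]; apply. Qed.

Lemma Ck_on_cst (E W : normedModType R) k A (c : W) :
  Ck_on k A (fun _ : E => c).
Proof.
elim: k c => [|k IH] c /=; first by move=> x _; exact: cst_continuous.
split=> [x _|v]; first exact: differentiable_cst.
have -> : (fun x : E => 'D_v (fun=> c) x) = fun=> 0; last exact: IH.
by apply/funext => x; exact: derive_cst.
Qed.

Lemma smooth_near_affine (E W : normedModType R) (l : {linear E -> W}) c x :
  continuous l -> smooth_near x (fun y => c + l y).
Proof.
move=> cl; exists setT; split=> [|//|k]; first exact: openT.
have df y : differentiable (fun y => c + l y) y.
  apply: (@differentiableD _ _ _ (cst c) l); first exact: differentiable_cst.
  exact: linear_differentiable.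
case: k => [|k]; first by move=> y _; exact: differentiable_continuous.
split=> [y _|v]; first exact: df.
have -> : (fun y => 'D_v (fun y => c + l y) y) = fun=> l v; last first.
  exact: Ck_on_cst.
apply/funext => y; rewrite deriveE //.
rewrite (_ : (fun y => c + l y) = cst c + l); last by [].
rewrite diffD //; [|exact: linear_differentiable].
by rewrite diff_cst diff_lin //= add0r.
Qed.

End Smooth.

Section LocalEquation.
Variables (R : realType) (V : vectType R).

(** By multilinearity the local equation is a polynomial in the coordinates of
    the frame. *)
Lemma differentiable_local_F n (Omega : ('I_n -> V) -> R) (omega : V -> V -> R)
    (e f : n.-tuple V) (w : 'M[R]_n -> n.-tuple V) :
  exterior_form Omega -> smooth_frame omega e f w ->
  differentiable (local_F Omega w) (0 : 'M[R]_n).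
Proof.
move=> /exterior_formP[ml _] [sw _]; pose b := vbasis (fullv : {vspace V}).
pose bv (j : 'I_(\dim (fullv : {vspace V}))) : V := b`_j.
rewrite (_ : local_F Omega w = fun S =>
    \sum_(k : {ffun 'I_n -> 'I_(\dim (fullv : {vspace V}))})
      (\prod_i coord b (k i) (tnth (w S) i)) *
      Omega (bv \o k)); last first.
  apply/funext => S.
  rewrite -(multilinear_expand bv (fun i j => coord b j (tnth (w S) i)) ml).
  congr Omega; by apply/funext => i; exact: coord_vbasis (memvf _).
apply: differentiable_bigsum => k.
apply: (@differentiableM _ _ (fun S => \prod_i coord b (k i) (tnth (w S) i))
    (cst _)); last exact: differentiable_cst.
apply: differentiable_bigprod => i.
by apply: smooth_near_differentiable; exact: (sw i (coord b (k i))).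
Qed.

Lemma diff_curve (E : normedModType R) (F : E -> R) (g : R -> E) t x :
  g t = x -> differentiable F x -> differentiable g t ->
  'd F x (derive1 g t) = derive1 (F \o g) t.
Proof.
move=> <- dF dg.
rewrite (derive1E' dg) derive1E'; last exact: differentiable_comp.
by rewrite (diff_comp dg dF).
Qed.

End LocalEquation.

(** * Curves of Lagrangian planes containing a hyperplane *)

Section Hyperplane.
Variables (R : realType) (V : vectType R) (omega : {skew_symmetric V}).

Lemma dimv_lt (H U : {vspace V}) x :
  (H <= U)%VS -> x \in U -> x \notin H -> (\dim H < \dim U)%N.
Proof.
move=> HU xU; rewrite ltnNge; apply: contra => dimUH.
by have /eqP -> : H == U by rewrite eqEdim HU.
Qed.

Lemma hyperplane_line (H L : {vspace V}) :
  (H <= L)%VS -> \dim L = (\dim H).+1 ->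
  exists x, [/\ x \in L, x \notin H &
    forall v, v \in L -> exists2 y, y \in H & exists c, v = y + c *: x].
Proof.
move=> HL dimL.
have /subvPn[x xL xH] : ~~ (L <= H)%VS.
  by apply: contraL (ltnSn (\dim H)) => /dimvS; rewrite dimL -leqNgt.
exists x; split=> // v vL.
have HxL : (H + <[x]> <= L)%VS by rewrite subv_add HL -memvE.
have /eqP LE : (H + <[x]>)%VS == L.
  rewrite eqEdim HxL dimL (dimv_lt (addvSl H <[x]>) _ xH) //.
  exact: subvP (addvSr H <[x]>) _ (memv_line x).
move: vL; rewrite -LE => /memv_addP[y yH [_ /vlineP[c ->] ->]].
by exists y => //; exists c.
Qed.

Lemma skew_span0 n (w : n.-tuple V) u v :
  (forall i j, omega (tnth w i) (tnth w j) = 0) ->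
  u \in <<w>>%VS -> v \in <<w>>%VS -> omega u v = 0.
Proof.
move=> iso /coord_span -> /coord_span ->.
rewrite (@scalar_lin_sum _ _ (omega _)); last by move=> a x y; rewrite skewPr.
apply: big1 => j _; rewrite skewC.
rewrite (@scalar_lin_sum _ _ (omega _)); last by move=> a x y; rewrite skewPr.
by rewrite big1 ?oppr0 ?mulr0 // => i _; rewrite -!tnth_nth iso mulr0.
Qed.

Definition graph_frame n (e f : n.-tuple V) (S : 'M[R]_n) : n.-tuple V :=
  [tuple tnth e i + \sum_j S i j *: tnth f j | i < n].

Lemma smooth_graph_frame n (e f : n.-tuple V) :
  smooth_frame omega e f (graph_frame e f).
Proof.
split=> [i phi|]; last first.
  apply: (@filterE _ (nbhs (0 : 'M[R]_n))) => S [dimS _].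
  by rewrite basisEdim size_tuple dimS leqnn andbT; exact: subvv.
pose l (S : 'M[R]_n) : R := \sum_j S i j * phi (tnth f j).
have ll : linear l.
  move=> a S T; rewrite /l scaler_sumr -big_split; apply: eq_bigr => j _.
  by rewrite !mxE mulrDl -mulrA.
pose ell : {linear 'M[R]_n -> R} :=
  HB.pack l (GRing.isLinear.Build _ _ _ _ _ ll).
have cl : continuous ell.
  move=> S; apply: differentiable_continuous.
  apply: (@differentiable_bigsum _ _ _ _
    (fun j (S : 'M[R]_n) => S i j * phi (tnth f j))) => j.
  apply: (@differentiableM _ _ (fun S : 'M[R]_n => S i j) (cst _)).
    exact: differentiable_coord.
  exact: differentiable_cst.
have := smooth_near_affine (phi (tnth e i)) (0 : 'M[R]_n) cl.
congr smooth_near; apply/funext => S.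
rewrite /graph_frame tnth_mktuple linearD linear_sum; congr (_ + _).
by apply: eq_bigr => j _; rewrite linearZ.
Qed.

(** Along a curve of Lagrangian planes [L_t] containing [H], the local equation
    is identically zero near the origin: [L_t] is [H + <x>] with [x] orthogonal
    to [H]. *)
Lemma characteristic_of_perp p (Omega : ('I_p.+1 -> V) -> R) (L H : {vspace V})
    (h : p.-tuple V) : exterior_form Omega -> basis_of H h ->
  (forall x, (forall i, omega (tnth h i) x = 0) ->
    Omega (fsnoc (tnth h) x) = 0) ->
  characteristic_at omega Omega L H.
Proof.
move=> fO bh O0 e f w ch sf X [g [sg g0 pro <-]].
have dg := smooth_near_differentiable sg.
have dF := differentiable_local_F fO sf.
rewrite (diff_curve g0 dF dg) derive1E.
rewrite (near_eq_derive (g := cst 0)) ?derive_cst //.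
have cg : (g @ nbhs (0 : R) --> nbhs (0 : 'M[R]_p.+1))%classic.
  by rewrite -g0; exact: differentiable_continuous.
have bw : \forall t \near (0 : R), lagrangian omega p.+1 (plane e f (g t)) ->
    basis_of (plane e f (g t)) (w (g t)) by exact: cg _ (proj2 sf).
near=> t.
have [lagt Ht] : prolongation omega p.+1 H (plane e f (g t)) by near: t.
have /(_ lagt) bt : lagrangian omega p.+1 (plane e f (g t)) ->
    basis_of (plane e f (g t)) (w (g t)) by near: t.
have [dimt isot] := lagt.
have [x [xP _ decomp]] : exists x, [/\ x \in plane e f (g t), x \notin H &
    forall v, v \in plane e f (g t) ->
      exists2 y, y \in H & exists c, v = y + c *: x].
  by apply: hyperplane_line => //; rewrite dimt (size_basis bh).
rewrite /= /local_F; apply: (exterior_form_snoc_eq0 fO bh (O0 x _)) => [i|i].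
  apply: isot => //; apply: (subvP Ht).
  by apply: (basis_mem bh); exact: mem_tnth.
by apply: decomp; apply: (basis_mem bt); exact: mem_tnth.
Unshelve. all: by end_near. Qed.

End Hyperplane.

Section Necessity.
Variables (R : realType) (V : vectType R) (omega : {skew_symmetric V}).

Lemma exists_chart_extending p (L H : {vspace V}) (h : p.-tuple V) x :
  \dim (fullv : {vspace V}) = (2 * p.+1)%N -> \dim L = p.+1 ->
  (H <= L)%VS -> basis_of H h -> x \in L -> x \notin H ->
  exists e f : p.+1.-tuple V, [/\ chart_at L e f,
    tnth e = fsnoc (tnth h) x & basis_of L^C f].
Proof.
move=> dimV dimL HL bh xL xH.
pose e := [tuple fsnoc (tnth h) x i | i < p.+1].
have eE i : tnth e i = fsnoc (tnth h) x i by rewrite tnth_mktuple.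
have eh i : tnth h i \in <<e>>%VS.
  by rewrite -(fsnoc_init (tnth h) x i) -eE memv_span // mem_tnth.
have xe : x \in <<e>>%VS.
  by rewrite -[x](fsnoc_last (tnth h)) -eE memv_span // mem_tnth.
have He : (H <= <<e>>)%VS.
  rewrite -(span_basis bh); apply/span_subvP => v /tnthP[i ->]; exact: eh.
have eL : (<<e>> <= L)%VS.
  apply/span_subvP => v /tnthP[i ->]; rewrite eE.
  case: (unliftP ord_max i) => [j|] ->; rewrite ?fsnoc_last // fsnoc_init.
  by apply: (subvP HL); apply: (basis_mem bh); exact: mem_tnth.
have /eqP LE : <<e>>%VS == L.
  by rewrite eqEdim eL dimL; have := dimv_lt He xe xH; rewrite (size_basis bh).
have be : basis_of L e by rewrite basisEdim LE subvv size_tuple dimL /=.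
have dimC : \dim L^C = p.+1 by rewrite dimv_compl dimV dimL mul2n -addnn addnK.
have bf : basis_of L^C (tcast dimC (vbasis L^C)) by rewrite val_tcast vbasisP.
exists e, (tcast dimC (vbasis L^C)); split=> //; last by apply/funext.
split=> //; rewrite -(addv_complf L); apply: cat_basis => //.
exact/directv_addP/capv_compl.
Qed.

(** Modulo [L], on which [Omega] vanishes, [u] can be taken in the complement
    spanned by the second half of the chart.  The chart then sees the curve
    [H + <x + t u>] as a line of matrices with a single nonzero row. *)
Lemma perp_of_characteristic p (Omega : ('I_p.+1 -> V) -> R)
    (L H : {vspace V}) (h : p.-tuple V) :
  \dim (fullv : {vspace V}) = (2 * p.+1)%N ->
  exterior_form Omega -> in_E omega Omega L -> (H <= L)%VS -> basis_of H h ->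
  characteristic_at omega Omega L H ->
  forall u, (forall i, omega (tnth h i) u = 0) -> Omega (fsnoc (tnth h) u) = 0.
Proof.
move=> dimV fO [[dimL isoL] OL] HL bh chr u hu.
have hL i : tnth h i \in L.
  by apply: (subvP HL); apply: (basis_mem bh); exact: mem_tnth.
have [x [xL xH _]] : exists x, [/\ x \in L, x \notin H &
    forall v, v \in L -> exists2 y, y \in H & exists c, v = y + c *: x].
  by apply: hyperplane_line => //; rewrite dimL (size_basis bh).
have [e [f [ch eE bf]]] := exists_chart_extending dimV dimL HL bh xL xH.
have OLx v : v \in L -> Omega (fsnoc (tnth h) v) = 0.
  move=> vL; apply: OL => i.
  by case: (unliftP ord_max i) => [j|] ->; rewrite ?fsnoc_last ?fsnoc_init.
have [l lL [u' uC uE]] :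
    exists2 l, l \in L & exists2 v, v \in L^C%VS & u = l + v.
  by apply/memv_addP; rewrite addv_complf memvf.
have lin := fsnoc_scalar (tnth h) fO.
have OD c v w : Omega (fsnoc (tnth h) (c *: v + w)) =
   c * Omega (fsnoc (tnth h) v) + Omega (fsnoc (tnth h) w) by exact: lin.
have -> : Omega (fsnoc (tnth h) u) = Omega (fsnoc (tnth h) u').
  by rewrite uE -[l]scale1r OD OLx // mulr0 add0r.
have hu' i : omega (tnth h i) u' = 0.
  by have := hu i; rewrite uE -[l]scale1r skewPr isoL // mulr0 add0r.
pose B : 'M[R]_p.+1 := \matrix_(i, j) ((i == ord_max)%:R * coord f j u').
pose g (t : R) := t *: B.
have frameE t : tnth (graph_frame e f (g t)) = fsnoc (tnth h) (x + t *: u').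
  apply/funext => i; rewrite tnth_mktuple eE.
  case: (unliftP ord_max i) => [j|] ->.
    rewrite !fsnoc_init big1 ?addr0 // => k _.
    by rewrite !mxE eq_sym (negbTE (neq_lift _ _)) mul0r mulr0 scale0r.
  rewrite !fsnoc_last [in RHS](coord_basis bf uC) scaler_sumr; congr (_ + _).
  by apply: eq_bigr => k _; rewrite !mxE eqxx mul1r scalerA (tnth_nth 0).
have sg : smooth_near (0 : R) g.
  have lg : linear g by move=> a s t; rewrite /g scalerDl scalerA.
  pose gl : {linear R -> 'M[R]_p.+1} :=
    HB.pack g (GRing.isLinear.Build _ _ _ _ _ lg).
  have := @smooth_near_affine _ _ _ gl 0 0 (@scalel_continuous _ _ B).
  by congr smooth_near; apply/funext => t; rewrite add0r.
have g0 : g 0 = 0 by rewrite /g scale0r.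
have pro t : prolongation omega p.+1 H (plane e f (g t)).
  have hP i : tnth h i \in plane e f (g t).
    rewrite -(fsnoc_init (tnth h) (x + t *: u') i) -frameE.
    by apply: memv_span; exact: mem_tnth.
  have HP : (H <= plane e f (g t))%VS.
    rewrite -(span_basis bh); apply/span_subvP => v /tnthP[i ->]; exact: hP.
  split=> //; split; last first.
    move=> v w; apply: (skew_span0 (w := graph_frame e f (g t))) => i j.
    have hh k k' : omega (tnth h k) (tnth h k') = 0 by apply: isoL.
    have hx k : omega (tnth h k) (x + t *: u') = 0.
      by rewrite addrC skewPr hu' isoL // mulr0 addr0.
    rewrite !frameE; case: (unliftP ord_max i) => [i'|] ->;
      case: (unliftP ord_max j) => [j'|] ->;
      rewrite ?fsnoc_init ?fsnoc_last ?skew0 ?hh ?hx //.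
    by rewrite skewC hx oppr0.
  apply/eqP; rewrite eqn_leq; apply/andP; split.
    by rewrite (leq_trans (dim_span _)) // size_tuple.
  have xP : x + t *: u' \in plane e f (g t).
    rewrite -[_ + _](fsnoc_last (tnth h)) -frameE.
    by apply: memv_span; exact: mem_tnth.
  (* x + t u' is outside H: otherwise t u' would lie in L and in L^C *)
  have := dimv_lt HP xP; rewrite (size_basis bh); apply.
  apply: contra xH => xtH.
  have tuL : t *: u' \in L.
    by rewrite -[t *: u'](addKr x) memvD ?memvN // (subvP HL).
  have : t *: u' \in (L :&: L^C)%VS by rewrite memv_cap tuL memvZ.
  by rewrite capv_compl memv0 => /eqP tu0; rewrite tu0 addr0 in xtH.
have tanX : tangent_prolongation omega H e f (derive1 g 0).
  by exists g; split=> //; apply: filterE => t; exact: pro.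
have sf := smooth_graph_frame omega e f.
have := chr e f _ ch sf _ tanX.
rewrite (diff_curve g0) ?derive1E; last 2 first.
- exact: differentiable_local_F fO sf.
- exact: smooth_near_differentiable sg.
have -> : local_F Omega (graph_frame e f) \o g =
    Omega (fsnoc (tnth h) u') *: (id : R -> R).
  apply/funext => t; rewrite /= /local_F frameE addrC OD (OLx x xL) addr0.
  by rewrite mulrC.
by rewrite deriveZ // derive_id /GRing.scale /= mulr1.
Qed.

End Necessity.

Theorem theorem3p14 (R : realType) (V : vectType R) (n : nat)
    (omega : {skew_symmetric V}) (Omega : ('I_n -> V) -> R) (L H : {vspace V})
    (dimV : \dim (fullv : {vspace V}) = (2 * n)%N)
    (symplectic_omega : is_psymplectic omega)
    (form_Omega : exterior_form Omega)
    (L_in_E : in_E omega Omega L)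
    (H_sub_L : (H <= L)%VS) (H_hyperplane : (\dim H).+1 = \dim L) :
  characteristic_at omega Omega L H <->
  exists sigma : ('I_n.-2 -> V) -> R,
    exterior_form sigma /\ form_isotropic (twist omega Omega sigma) H.
Proof.
have [[dimL isoL] _] := L_in_E.
have nE : n = (\dim H).+1 by rewrite H_hyperplane.
clear dimL H_hyperplane; subst n.
pose h := vbasis H; have bh : basis_of H h := vbasisP H.
have hL i : tnth h i \in L.
  by apply: (subvP H_sub_L); apply: (basis_mem bh); exact: mem_tnth.
have iso i j : omega (tnth h i) (tnth h j) = 0 by apply: isoL.
have perpE := exists_isotropic_twist form_Omega bh iso.
split=> [charH|isoH].
  exact/perpE/(perp_of_characteristic dimV form_Omega L_in_E H_sub_L bh charH).
exact: characteristic_of_perp form_Omega bh (proj1 perpE isoH).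
Qed.
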